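(* Endow $\mathbb{R}^2$ with the density $f(x,y)=\exp(-x^2-y^4)$, of total mass $M=\int_{\mathbb{R}^2}f\,dx\,dy<\infty$. Among half-planes with prescribed weighted volume $v\in(0,M)$: for volume fractions $v/M$ near $1/2$, horizontal lines have less (weighted) perimeter than vertical lines enclosing the same volume; and for small or large volumes (i.e. $v$ close to $0$ or close to $M$), vertical lines have less perimeter than horizontal lines enclosing the same volume.
   Context: The weighted volume of a set is $\int_E f\,dx\,dy$, and the weighted perimeter of a half-plane bounded by a line $\ell$ is $\int_\ell f\,d\mathcal{H}^1$. ''Horizontal line enclosing volume $v$'' means a line $\{y=c\}$ bounding a half-plane of weighted volume $v$; similarly ''vertical line'' means $\{x=c\}$. ''Near'' and ''close to'' mean: in some neighbourhood of the value in question. *)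

(* Defs.v *)
From mathcomp Require Import all_boot all_order all_algebra.
From mathcomp Require Import all_classical all_reals all_analysis.

Set Implicit Arguments.
Unset Strict Implicit.
Unset Printing Implicit Defensive.

Import Order.TTheory GRing.Theory Num.Theory.
Import numFieldNormedType.Exports.

Local Open Scope classical_set_scope.
Local Open Scope ring_scope.

Notation plane R := (measurableTypeR R * measurableTypeR R)%type.

(* The canonical norm on [R * R] is the sup norm; Hausdorff measure needs the
   Euclidean distance. *)
Definition euclidean_dist (R : realType) (p q : plane R) : R :=
  Num.sqrt ((p.1 - q.1) ^+ 2 + (p.2 - q.2) ^+ 2).

(* The point 0 is added so that the empty set has diameter 0, not -oo. *)
Definition diam (R : realType) (A : set (plane R)) : \bar R :=
  ereal_sup ([set 0%E] `|`
    [set (euclidean_dist p q)%:E | p in A & q in A]).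

Definition hausdorff1_pre (R : realType) (delta : R) (A : set (plane R))
    : \bar R :=
  ereal_inf [set (\sum_(0 <= k <oo) diam (U k))%E | U in
    [set U : nat -> set (plane R) |
      A `<=` \bigcup_k U k /\ forall k, (diam (U k) <= delta%:E)%E]].

(* Normalized so that a segment has measure its length.  This is an outer
   measure, which is countably additive on the Borel sets; [integral] accepts
   any set function and evaluates it only on sets [h @^-1` [set r]] with [h]
   simple, hence Borel. *)
Definition hausdorff1 (R : realType) (A : set (plane R)) : \bar R :=
  ereal_sup [set hausdorff1_pre delta A | delta in [set d : R | 0 < d]].

Definition density (R : realType) (p : plane R) : R :=
  expR (- p.1 ^+ 2 - p.2 ^+ 4).

Definition weighted_volume (R : realType) (E : set (plane R)) : \bar R :=
  (\int[(@lebesgue_measure R \x @lebesgue_measure R)%E]_(p in E)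
     (density p)%:E)%E.

Definition weighted_length (R : realType) (l : set (plane R)) : \bar R :=
  (\int[@hausdorff1 R]_(p in l) (density p)%:E)%E.

Definition total_mass (R : realType) : \bar R :=
  weighted_volume (setT : set (plane R)).

Definition hline (R : realType) (c : R) : set (plane R) :=
  [set p : plane R | p.2 = c].
Definition vline (R : realType) (c : R) : set (plane R) :=
  [set p : plane R | p.1 = c].

(* A line encloses volume [v] if one of the two half-planes it bounds does. *)
Definition hline_encloses (R : realType) (c v : R) : Prop :=
  weighted_volume [set p : plane R | p.2 <= c] = v%:E \/
  weighted_volume [set p : plane R | c <= p.2] = v%:E.

Definition vline_encloses (R : realType) (c v : R) : Prop :=
  weighted_volume [set p : plane R | p.1 <= c] = v%:E \/
  weighted_volume [set p : plane R | c <= p.1] = v%:E.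

Definition horizontal_beats_vertical (R : realType) (v : R) : Prop :=
  forall b a : R, hline_encloses b v -> vline_encloses a v ->
    (weighted_length (hline b) < weighted_length (vline a))%E.

Definition vertical_beats_horizontal (R : realType) (v : R) : Prop :=
  forall a b : R, vline_encloses a v -> hline_encloses b v ->
    (weighted_length (vline a) < weighted_length (hline b))%E.

(* Main.v *)
(* With g(x) = exp(-x^2), h(y) = exp(-y^4) and A = int g, B = int h, a
   horizontal line y = b bounds volume A int_b^oo h and has perimeter A h(b),
   and a vertical line x = a bounds volume B int_a^oo g and has perimeter
   B g(a).

   At half the volume b = a = 0, and the perimeters are A < B.  Both integrals
   over [0, +oo[ are compared with derivatives of functions q g and r h, with q
   and r polynomial on [0, 1] and rational on [1, +oo[; after division by
   exp(-1), A < B becomes an inequality between rational numbers.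

   For small volumes int_a^oo g ~ g(a) / (2 a) and int_b^oo h ~ h(b) / (4 b^3),
   so that the ratio of the vertical to the horizontal perimeter is about
   a / (2 b^3); it is small since a^2 ~ b^4.  Volumes close to the total mass M
   reduce to small ones, because a line that encloses v also encloses M - v. *)
From HB Require Import structures.
Require Import Defs.
From mathcomp Require Import all_boot all_order all_algebra.
From mathcomp Require Import all_classical all_reals all_analysis.
From mathcomp Require Import measurable_realfun ring lra.
Import Order.TTheory GRing.Theory Num.Theory.
Import numFieldNormedType.Exports.
Local Open Scope classical_set_scope.
Local Open Scope ring_scope.

Set Implicit Arguments.
Unset Strict Implicit.
Unset Printing Implicit Defensive.

(** * The Hausdorff measure of a subset of a line *)

Section line_measure.
Variables (R : realType) (iota : R -> plane R) (pr : plane R -> R).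
(** [iota] parametrizes the line by arc length, and [pr] is a projection onto it that does not
    increase distances. *)
Hypothesis prK : cancel iota pr.
Hypothesis iota_dist : forall s t, euclidean_dist (iota s) (iota t) = `|s - t|.
Hypothesis pr_dist : forall p q, `|pr p - pr q| <= euclidean_dist p q.
Local Notation mu := (@lebesgue_measure R).

Lemma diam_ge0 (A : set (plane R)) : (0 <= diam A)%E.
Proof. by apply: ereal_sup_ubound; left. Qed.

Lemma diam_set0 : diam (set0 : set (plane R)) = 0%E.
Proof.
rewrite /diam; have -> : [set (euclidean_dist p q)%:E | p in set0 & q in set0]
    = set0 :> set (\bar R) by rewrite -subset0 => z [p].
by rewrite setU0 ereal_sup1.
Qed.

Lemma diam_image_itvoc (a b : R) : a <= b ->
  (diam (iota @` [set` `]a, b]]) <= (b - a)%:E)%E.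
Proof.
move=> ab; apply: ge_ereal_sup => y [->|]; first by rewrite lee_fin subr_ge0.
case=> p [s sab sp] [q [t tab tq]] <-; rewrite -sp -tq {p sp q tq}.
move: sab tab; rewrite /= !in_itv/= iota_dist lee_fin ler_distlC.
move=> /andP[? ?] /andP[? ?].
by apply/andP; split; lra.
Qed.

(** The sets of a Hausdorff cover are arbitrary; their projections are enlarged to intervals so that
    Lebesgue subadditivity applies. As [pr] is 1-Lipschitz, an interval of length [diam A] starting
    at the infimum suffices. *)
Lemma measurable_hull (A : set (plane R)) :
  exists J : set (measurableTypeR R),
    [/\ measurable J, pr @` A `<=` J & (mu J <= diam A)%E].
Proof.
have [->|/set0P[p0 Ap0]] := eqVneq A set0.
  by exists set0; split; rewrite ?image_set0 ?measure0 ?diam_ge0.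
have pr_diam p q : A p -> A q -> ((pr p - pr q)%:E <= diam A)%E.
  move=> Ap Aq; apply: (@le_trans _ _ (euclidean_dist p q)%:E).
    by rewrite lee_fin (le_trans (ler_norm _)).
  by apply: ereal_sup_ubound; right; exists p => //; exists q.
case dA : (diam A) pr_diam => [d| |] pr_diam.
- pose m := inf (pr @` A).
  have lbA : lbound (pr @` A) (pr p0 - d).
    by move=> _ [p Ap <-]; have := pr_diam _ _ Ap0 Ap; rewrite lee_fin; lra.
  have hA : has_lbound (pr @` A) by exists (pr p0 - d).
  exists [set` `[m, m + d]]; split.
  + exact: measurable_itv.
  + move=> _ [p Ap <-]; rewrite /= in_itv/=; apply/andP; split.
      by apply: ge_inf => //; exists p.
    rewrite -lerBlDr; apply: lb_le_inf; first by exists (pr p0), p0.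
    by move=> _ [q Aq <-]; have := pr_diam _ _ Ap Aq; rewrite lee_fin; lra.
  + rewrite lebesgue_measure_itv/= lte_fin -EFinB (addrC m) addrK.
    by case: ifPn => // _; have := diam_ge0 A; rewrite dA.
- by exists setT; split => //; rewrite leey.
- by have := diam_ge0 A; rewrite dA.
Qed.

(** The hulls of the projected sets of any cover of the image cover [S], and their measures are at
    most the diameters. *)
Lemma hausdorff1_pre_ge (delta : R) (S : set (measurableTypeR R)) :
  measurable S -> (mu S <= hausdorff1_pre delta (iota @` S))%E.
Proof.
move=> mS; apply: le_ereal_inf_tmp => _ [U [SU _] <-].
have [J /all_and3[mJ UJ JU]] := choice (fun k => measurable_hull (U k)).
apply: (@le_trans _ _ (\sum_(0 <= k <oo) mu (J k))%E).
  apply: measure_sigma_subadditive => // t St.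
  have [k _ Ukt] := SU _ (imageP iota St).
  by exists k => //; apply: UJ; rewrite -(prK t); exact: imageP.
by apply: lee_nneseries => // k _; exact: JU.
Qed.

(* Extending this set function to an outer measure on the line gives the
   countable subadditivity of [hausdorff1_pre delta] along the line. *)
Let diam_le (delta : R) (A : set (measurableTypeR R)) : \bar R :=
  if (diam (iota @` A) <= delta%:E)%E then diam (iota @` A) else +oo%E.

Let diam_le_ge0 delta A : (0 <= diam_le delta A)%E.
Proof. by rewrite /diam_le; case: ifPn => // _; exact: diam_ge0. Qed.

Let diam_le_set0 delta : 0 < delta -> diam_le delta set0 = 0%E.
Proof. by move=> d0; rewrite /diam_le image_set0 diam_set0 lee_fin ltW. Qed.

Let diam_le_itv delta a b : 0 < delta -> a <= b ->
  (mu_ext (diam_le delta) [set` `]a, b]] <= (b - a)%:E)%E.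
Proof.
move=> delta0 ab.
(* Cut the interval into [N] equal pieces of length [h <= delta]; their diameters add up to at most
   [b - a]. *)
pose N := (Num.truncn ((b - a) / delta)).+1.
have N0 : 0 < N%:R :> R by rewrite ltr0n.
pose h := (b - a) / N%:R.
have h0 : 0 <= h by rewrite divr_ge0 ?subr_ge0// ltW.
have hd : h <= delta.
  rewrite ler_pdivrMr// mulrC -ler_pdivrMr// ltW//.
  by rewrite /N; apply: truncnS_gt.
(* Counting from the right end makes the pieces open on the left, so that the piece containing [x]
   has index the integer part of [(b - x) / h]. *)
pose F k : set (measurableTypeR R) :=
  if (k < N)%N then [set` `]b - k.+1%:R * h, b - k%:R * h]] else set0.
have Fh k : (k < N)%N -> (diam_le delta (F k) <= h%:E)%E.
  move=> kN; have dF : (diam (iota @` F k) <= h%:E)%E.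
    rewrite /F kN; apply: le_trans.
      by apply: diam_image_itvoc; rewrite lerB// ler_wpM2r// ler_nat.
    by rewrite lee_fin -natr1; lra.
  by rewrite /diam_le (le_trans dF _) ?lee_fin.
apply: (@le_trans _ _ (\sum_(0 <= k <oo) diam_le delta (F k))%E).
  apply: ereal_inf_lbound; exists F => //; split.
    by move=> k; rewrite /F; case: ifPn => // _; exact: measurable_itv.
  move=> x /=; rewrite in_itv/= => /andP[ax xb].
  have h_gt0 : 0 < h by rewrite divr_gt0 ?subr_gt0// (lt_le_trans ax).
  pose k := Num.truncn ((b - x) / h).
  have bx : 0 <= b - x by rewrite subr_ge0.
  have := truncn_itv (divr_ge0 bx h0).
  rewrite -/k ler_pdivlMr// ltr_pdivrMr// => /andP[kx xk].
  have kN : (k < N)%N.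
    have Nh : N%:R * h = b - a by rewrite mulrC divfK// gt_eqF.
    have : k%:R * h < N%:R * h by rewrite Nh (le_lt_trans kx)// ltrD2l ltrN2.
    by rewrite ltr_pM2r// ltr_nat.
  by exists k => //; rewrite /F kN /= in_itv/=; apply/andP; split; lra.
rewrite (nneseries_split 0 N) => //.
rewrite add0n [X in (_ + X)%E]eseries0 ?adde0; last first.
  by move=> k Nk _; rewrite /F ltnNge Nk /= diam_le_set0.
apply: (@le_trans _ _ (\sum_(0 <= k < N) h%:E)%E).
  by rewrite !big_nat; apply: lee_sum => k /= kN; exact: Fh.
rewrite sumEFin lee_fin sumr_const_nat subn0 -mulr_natl /h mulrCA mulfV.
  by rewrite mulr1.
by rewrite gt_eqF.
Qed.

(** The outer measure of [diam_le] lies in between: its covers of finite cost are Hausdorff covers,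
    and Lebesgue measure is an infimum over covers by half-open intervals, on each of which
    [diam_le_itv] applies. *)
Lemma hausdorff1_pre_le (delta : R) (S : set (measurableTypeR R)) :
  0 < delta -> (hausdorff1_pre delta (iota @` S) <= mu S)%E.
Proof.
move=> delta0; apply: (@le_trans _ _ (mu_ext (diam_le delta) S)).
  apply: le_ereal_inf_tmp => _ [F [mF SF] <-].
  have [[k Fk]|/forallNP Ffin] :=
      pselect (exists k, diam_le delta (F k) = +oo%E).
    by rewrite (eseries_pinfty _ _ Fk) ?leey// => n _;
      rewrite gt_eqF// (lt_le_trans _ (diam_le_ge0 _ _)).
  have Fd k : (diam (iota @` F k) <= delta%:E)%E.
    by have := Ffin k; rewrite /diam_le; case: ifPn.
  apply: ereal_inf_lbound; exists (fun k => iota @` F k).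
    split => // _ [s /SF[k _ Fks] <-]; exists k => //; exact: imageP.
  by apply: eq_eseriesr => k _; rewrite /diam_le Fd.
apply: le_ereal_inf_tmp => _ [F [mF SF] <-].
apply: (@le_trans _ _ (mu_ext (diam_le delta) (\bigcup_k F k))).
  exact: le_mu_ext.
apply: (le_trans (mu_ext_sigma_subadditive (diam_le_ge0 delta) _)).
apply: lee_nneseries => [k _ _|k _].
  by apply: mu_ext_ge0 => X; exact: diam_le_ge0.
have [->|[[a b] /= ab ->]] := (ocitvP _).1 (mF k).
  by rewrite mu_ext0 ?wlength0//; exact: diam_le_set0.
rewrite wlength_itv/= lte_fin ab; apply: diam_le_itv => //; exact: ltW.
Qed.

Lemma hausdorff1_line (S : set (measurableTypeR R)) :
  measurable S -> hausdorff1 (iota @` S) = mu S.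
Proof.
move=> mS; apply/eqP; rewrite eq_le; apply/andP; split.
  by apply: ge_ereal_sup => _ [delta delta0 <-]; exact: hausdorff1_pre_le.
apply: (le_trans (hausdorff1_pre_ge 1 mS)).
by apply: ereal_sup_ubound; exists 1 => //=.
Qed.

End line_measure.

(** * Integration over a line against the Hausdorff measure *)

Import HBNNSimple.

(** Carries simple functions from the plane to the line along [iota], and back along [pr]. *)
Lemma nnsfun_comp d d' (T : measurableType d) (T' : measurableType d')
    (R : realType) (f : {nnsfun T >-> R}) (g : T' -> T) :
  measurable_fun setT g -> exists h : {nnsfun T' >-> R}, h =1 f \o g.
Proof.
move=> mg.
have mh : @isMeasurableFun _ _ T' R (f \o g).
  by split; exact: measurableT_comp.
have fh : @FiniteImage T' R (f \o g).
  split; apply: sub_finite_set (@fimfunP _ _ f).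
  by move=> _ [x _ <-]; exists (g x).
have nh : @isNonNegFun T' R (f \o g) by split => x /=.
pose H : {nnsfun T' >-> R} := HB.pack (f \o g) mh fh nh.
by exists H.
Qed.

Section line_integral.
Variables (R : realType) (iota : R -> plane R) (pr : plane R -> R).
Hypothesis prK : cancel iota pr.
Hypothesis iota_dist : forall s t, euclidean_dist (iota s) (iota t) = `|s - t|.
Hypothesis pr_dist : forall p q, `|pr p - pr q| <= euclidean_dist p q.
Hypothesis miota : measurable_fun setT (iota : measurableTypeR R -> plane R).
Hypothesis mpr : measurable_fun setT (pr : plane R -> measurableTypeR R).
Hypothesis mline : measurable (range iota).
Local Notation mu := (@lebesgue_measure R).

(** A level set of [h] at a nonzero value lies on the line and is the image of that of [k]; the
    value 0 contributes 0 even if its level set has infinite measure. *)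
Lemma sintegral_hausdorff1_line (h : {nnsfun plane R >-> R})
    (k : {nnsfun (measurableTypeR R) >-> R}) :
  (forall p, h p != 0 -> range iota p) -> (forall t : R, k t = h (iota t)) ->
  sintegral (@hausdorff1 R) h = sintegral mu k.
Proof.
move=> h0 kh; rewrite !sintegralET; apply: eq_fsbigr => r _.
have [->|r0] := eqVneq r 0; first by rewrite !mul0e.
congr (_ * _)%E; rewrite -(hausdorff1_line prK iota_dist pr_dist)//.
congr hausdorff1; apply/seteqP; split => [p /= hp|_ [s /= ks <-]].
  by have [|s _ sp] := h0 p; [rewrite hp|exists s; rewrite //= kh /= sp].
by rewrite -ks kh.
Qed.

(** Both suprema run over the same set of values: [h] below [phi] restricts to [h \o iota], and [k]
    extends to [k \o pr] cut off outside the line. *)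
Lemma nnintegral_hausdorff1_line (phi : plane R -> \bar R) :
  (forall p, (0 <= phi p)%E) -> (forall p, phi p != 0%E -> range iota p) ->
  ereal_sup [set sintegral (@hausdorff1 R) h |
    h in [set h : {nnsfun plane R >-> R} | forall p, ((h p)%:E <= phi p)%E]] =
  ereal_sup [set sintegral mu k |
    k in [set k : {nnsfun (measurableTypeR R) >-> R} |
      forall t, ((k t)%:E <= phi (iota t))%E]].
Proof.
move=> phi0 phiN; congr ereal_sup; apply/seteqP; split.
- move=> _ [h /= hphi <-].
  have [k kE] := nnsfun_comp h miota.
  exists k; first by move=> t; rewrite kE; exact: hphi.
  apply/esym/sintegral_hausdorff1_line => // p hp0; apply: phiN.
  rewrite gt_eqF// (lt_le_trans _ (hphi p))// lte_fin lt_neqAle eq_sym hp0.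
  exact: fun_ge0.
- move=> _ [k /= kphi <-].
  have [h hE] := nnsfun_comp k mpr.
  exists (proj_nnsfun h mline).
    move=> p /=; rewrite mindicE.
    have [|_] := boolP (p \in _); last by rewrite mulr0.
    by rewrite inE => -[t _ <-]; rewrite mulr1 hE/= prK.
  apply: sintegral_hausdorff1_line => [p /=|t /=].
    rewrite mindicE; have [/set_mem//|_] := boolP (p \in _).
    by rewrite mulr0 eqxx.
  by rewrite mindicE mem_set ?mulr1 ?hE/= ?prK//; exact: imageT.
Qed.

Lemma integral_hausdorff1_line (f : plane R -> \bar R) :
  (\int[@hausdorff1 R]_(p in range iota) f p = \int[mu]_t f (iota t))%E.
Proof.
have fi t : (f \_ (range iota)) (iota t) = f (iota t).
  by rewrite patchE mem_set//; exact: imageT.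
have fN p : (f \_ (range iota)) p != 0%E -> range iota p.
  by rewrite patchE; case: ifPn => [/set_mem//|_]; rewrite eqxx.
rewrite /integral !nnintegral_hausdorff1_line//.
- congr (ereal_sup _ - ereal_sup _)%E; congr (image _ _); apply/funext => k;
    apply/propext; split => /= + t => /(_ t);
    by rewrite !(funeposE, funenegE) fi patchT// inE.
- move=> p; apply: contra_neqP; move=> /(contra_not (fN p))/negP/negPn/eqP.
  by rewrite funenegE => ->; rewrite oppe0 maxxx.
- move=> p; apply: contra_neqP; move=> /(contra_not (fN p))/negP/negPn/eqP.
  by rewrite funeposE => ->; rewrite maxxx.
Qed.
End line_integral.

(** * Weighted volumes and lengths as one-dimensional integrals *)

(** The functions g and h are the cases [n = 2] and [n = 4]. *)
Definition expow (R : realType) (n : nat) (x : R) : R := expR (- x ^+ n).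

HB.lock Definition mass (R : realType) (n : nat)
    (D : set (measurableTypeR R)) : \bar R :=
  (\int[@lebesgue_measure R]_(x in D) (expow n x)%:E)%E.

Section expow.
Variable R : realType.
Implicit Types (n : nat) (x : R).
Local Notation mu := (@lebesgue_measure R).

Lemma expow_gt0 n x : 0 < expow n x. Proof. exact: expR_gt0. Qed.

Lemma expow_ge0 n x : 0 <= expow n x. Proof. exact: expR_ge0. Qed.

Lemma expow_opp n x : ~~ odd n -> expow n (- x) = expow n x.
Proof.
by move=> n_even; rewrite /expow exprNn -signr_odd (negbTE n_even) mul1r.
Qed.

Lemma density_expow (p : plane R) : density p = expow 2 p.1 * expow 4 p.2.
Proof. by rewrite /density expRD. Qed.

Lemma continuous_expow n : continuous (@expow R n).
Proof.
move=> x; apply: (@continuous_comp _ _ _ (fun x : R => - x ^+ n) expR).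
  by apply: cvgN; exact: exprn_continuous.
exact: continuous_expR.
Qed.

Lemma measurable_expow n (D : set (measurableTypeR R)) :
  measurable_fun D (EFin \o @expow R n).
Proof.
apply: measurable_funTS; apply/measurable_EFinP.
apply: continuous_measurable_fun; exact: continuous_expow.
Qed.

Lemma mass_ge0 n (D : set (measurableTypeR R)) : (0 <= mass n D)%E.
Proof.
by rewrite mass.unlock integral_ge0// => x _; rewrite lee_fin expow_ge0.
Qed.

Lemma le_mass n (D E : set (measurableTypeR R)) :
  measurable D -> measurable E -> D `<=` E -> (mass n D <= mass n E)%E.
Proof.
move=> mD mE DE; rewrite mass.unlock; apply: ge0_subset_integral => //.
  exact: measurable_expow.
by move=> x _; rewrite lee_fin expow_ge0.
Qed.

(** Tonelli: the density and the indicator of a rectangle both factor into a function of x and a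
    function of y. *)
Lemma weighted_volume_setX (A B : set (measurableTypeR R)) :
  measurable A -> measurable B ->
  weighted_volume (A `*` B) = (mass 2 A * mass 4 B)%E.
Proof.
move=> mA mB; rewrite mass.unlock /weighted_volume integral_mkcond.
pose a := (EFin \o @expow R 2) \_ A; pose b := (EFin \o @expow R 4) \_ B.
have a0 x : (0 <= a x)%E.
  by rewrite /a patchE; case: ifPn => // _; rewrite lee_fin expow_ge0.
have b0 x : (0 <= b x)%E.
  by rewrite /b patchE; case: ifPn => // _; rewrite lee_fin expow_ge0.
have ma : measurable_fun setT a.
  by apply/(measurable_restrictT _ mA); exact: measurable_expow.
have mb : measurable_fun setT b.
  by apply/(measurable_restrictT _ mB); exact: measurable_expow.
rewrite (eq_integral (fun p => a p.1 * b p.2)%E); last first.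
  move=> [x y] _; rewrite /a /b !patchE in_setX/=.
  case: (x \in A); case: (y \in B); rewrite /= ?mul0e ?mule0//.
  by rewrite density_expow EFinM.
rewrite fubini_tonelli1; last 2 first.
  - by apply: emeasurable_funM; apply: measurableT_comp.
  - by move=> p; rewrite mule_ge0.
rewrite /fubini_F /=.
under eq_integral do rewrite ge0_integralZl//.
rewrite ge0_integralZr//; last by apply: integral_ge0.
by rewrite /a /b -!integral_mkcond.
Qed.

Lemma weighted_length_hline c : weighted_length (hline c) =
  ((expow 4 c)%:E * mass 2 [set: measurableTypeR R])%E.
Proof.
have -> : hline c = range (fun x => (x, c)).
  apply/seteqP; split => [[x y] yc|_ [x _ <-]//].
  by exists x => //; rewrite -(yc : y = c).
rewrite mass.unlock /weighted_length (@integral_hausdorff1_line _ _ fst)//.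
- rewrite (eq_integral (fun x : measurableTypeR R =>
    (expow 4 c)%:E * (expow 2 x)%:E)%E); last first.
    by move=> x _; rewrite density_expow EFinM muleC.
  rewrite ge0_integralZl//; first exact: measurable_expow.
  + by move=> x _; rewrite lee_fin expow_ge0.
  + by rewrite lee_fin expow_ge0.
- by move=> s t; rewrite /euclidean_dist subrr expr0n addr0 sqrtr_sqr.
- move=> p q; rewrite /euclidean_dist -sqrtr_sqr ler_sqrt ?addr_ge0 ?sqr_ge0//.
  by rewrite lerDl sqr_ge0.
- rewrite [X in measurable X](_ : _ = setT `*` [set c]).
    by apply: measurableX => //; exact: measurable_set1.
  apply/seteqP; split => [_ [x _ <-]//|[x y] [_ /= yc]].
  by exists x => //; rewrite yc.
Qed.

Lemma weighted_length_vline c : weighted_length (Defs.vline c) =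
  ((expow 2 c)%:E * mass 4 [set: measurableTypeR R])%E.
Proof.
have -> : Defs.vline c = range (fun y => (c, y)).
  apply/seteqP; split => [[x y] xc|_ [y _ <-]//].
  by exists y => //; rewrite -(xc : x = c).
rewrite mass.unlock /weighted_length (@integral_hausdorff1_line _ _ snd)//.
- rewrite (eq_integral (fun y : measurableTypeR R =>
    (expow 2 c)%:E * (expow 4 y)%:E)%E); last first.
    by move=> y _; rewrite density_expow EFinM.
  rewrite ge0_integralZl//; first exact: measurable_expow.
  + by move=> x _; rewrite lee_fin expow_ge0.
  + by rewrite lee_fin expow_ge0.
- by move=> s t; rewrite /euclidean_dist subrr expr0n add0r sqrtr_sqr.
- move=> p q; rewrite /euclidean_dist -sqrtr_sqr ler_sqrt ?addr_ge0 ?sqr_ge0//.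
  by rewrite lerDr sqr_ge0.
- rewrite [X in measurable X](_ : _ = [set c] `*` setT).
    by apply: measurableX => //; exact: measurable_set1.
  apply/seteqP; split => [_ [y _ <-]//|[x y] [/= xc _]].
  by exists y => //; rewrite xc.
Qed.

End expow.

(** * Bounds for the integrals of exp(-x^n) *)

Section tail_bounds.
Variables (R : realType) (m : nat) (p d : {poly R}) (a K : R).
Hypothesis d_gt0 : forall x, a <= x -> 0 < d.[x].
Hypothesis p_ge0 : forall x, a <= x -> 0 <= p.[x].
Hypothesis p_le : forall x, a <= x -> p.[x] <= K * d.[x].
Local Notation mu := (@lebesgue_measure R).
Local Notation n := m.+1.
Implicit Types x : R.

(** [f] is the derivative of [F], and [F] vanishes at infinity, so [f] integrates to [- F a] over
    the half-line. Comparing [r / d ^+ 2] with 1 then compares this value with the mass. *)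
Let F x := - (p.[x] / d.[x] * expow n x).
Let r := n%:R *: 'X^m * p * d - p^`() * d + p * d^`().
Let f x := r.[x] / d.[x] ^+ 2 * expow n x.

Lemma is_derive_expow x :
  is_derive x 1 (@expow R n) (- (n%:R * x ^+ m) * expow n x).
Proof.
have dX : is_derive x 1 (fun y : R => - y ^+ n) (- (n%:R * x ^+ m)).
  have -> : (fun y : R => - y ^+ n) = - (id ^+ n : R -> R).
    by apply/funext => y; rewrite fctE /= !fctE.
  by apply: is_derive_eq; rewrite /GRing.scale /= mulr1.
by rewrite mulrC; exact: is_derive1_comp.
Qed.

Let is_derive_F x : a <= x -> is_derive x 1 F (f x).
Proof.
move=> ax; have dx0 : d.[x] != 0 by rewrite gt_eqF ?d_gt0.
have de := is_derive_expow x.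
have dV : is_derive x 1 (fun y => (d.[y])^-1) (- (d.[x]) ^- 2 *: d^`().[x]).
  exact: is_deriveV.
rewrite /F; apply: is_derive_eq.
rewrite /f /r !hornerE /GRing.scale /=.
by field.
Qed.

Let continuous_f x : a <= x -> {for x, continuous f}.
Proof.
move=> ax; have dx0 : d.[x] != 0 by rewrite gt_eqF ?d_gt0.
have cd := @continuous_horner R d x.
apply: cvgM; last exact: continuous_expow.
apply: cvgM; first exact: continuous_horner.
apply: cvgV; first by rewrite expf_neq0.
exact: (cvg_comp _ _ cd (@exprn_continuous _ 2 _)).
Qed.

Let within_continuous_f : {within `[a, +oo[, continuous f}.
Proof.
apply/continuous_within_itvcyP; split.
  by move=> x; rewrite in_itv/= andbT => /ltW; exact: continuous_f.
exact/cvg_at_right_filter/continuous_f.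
Qed.

Let F_cvg0 : F x @[x --> +oo] --> 0.
Proof.
rewrite -oppr0; apply: cvgN.
(* The quotient [p / d] is at most [K], and [x <= x ^+ n] once [1 <= x]. *)
apply: (@squeeze_cvgr _ _ _ _ (cst 0) (fun x => K * expR (- x))).
- near=> x.
  have ax : a <= x by near: x; apply: nbhs_pinfty_ge; rewrite num_real.
  have x1 : 1 <= x by near: x; apply: nbhs_pinfty_ge; rewrite num_real.
  have q0 : 0 <= p.[x] / d.[x].
    by apply: divr_ge0; [exact: p_ge0|exact/ltW/d_gt0].
  apply/andP; split; first by rewrite /= mulr_ge0 ?expow_ge0.
  apply: ler_pM; rewrite ?expow_ge0//.
    by rewrite ler_pdivrMr ?d_gt0 ?p_le.
  by rewrite ler_expR lerN2 exprS ler_peMr ?exprn_ege1// (le_trans _ x1).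
- exact: cvg_cst.
- by rewrite -(mulr0 K); apply: cvgM; [exact: cvg_cst|exact: cvgr_expR].
Unshelve. all: by end_near. Qed.

Let integral_f : (forall x, a <= x -> 0 <= r.[x]) ->
  (\int[mu]_(x in `[a, +oo[) (f x)%:E = (p.[a] / d.[a] * expow n a)%:E)%E.
Proof.
move=> r0; rewrite (@ge0_continuous_FTC2y _ f F a 0) => //.
- by rewrite sub0e EFinN oppeK.
- by move=> x ax; rewrite mulr_ge0 ?divr_ge0 ?expow_ge0 ?sqr_ge0 ?r0.
- by move=> x /ltW/is_derive_F[].
- apply/cvg_at_right_filter/differentiable_continuous/derivable1_diffP.
  by case: (is_derive_F (lexx a)).
- move=> x; rewrite in_itv/= andbT => /ltW/is_derive_F df.
  by rewrite derive1E derive_val.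
Qed.

Let measurable_f : measurable_fun `[a, +oo[ (EFin \o f).
Proof.
by apply/measurable_EFinP; apply: subspace_continuous_measurable_fun.
Qed.

Lemma mass_tail_ge : (forall x, a <= x -> 0 <= r.[x] <= d.[x] ^+ 2) ->
  ((p.[a] / d.[a] * expow n a)%:E <= mass n [set` `[a, +oo[])%E.
Proof.
move=> rd; rewrite mass.unlock -integral_f => [|x ax]; last first.
  by have /andP[] := rd x ax.
apply: ge0_le_integral => //.
- move=> x; rewrite /= in_itv/= andbT => ax; rewrite lee_fin.
  rewrite mulr_ge0 ?divr_ge0 ?expow_ge0 ?sqr_ge0//.
  by have /andP[] := rd x ax.
- exact: measurable_expow.
- move=> x; rewrite /= in_itv/= andbT => ax; rewrite lee_fin.
  rewrite ler_piMl ?expow_ge0// ler_pdivrMr ?exprn_gt0 ?d_gt0// mul1r.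
  by have /andP[] := rd x ax.
Qed.

Lemma mass_tail_le : (forall x, a <= x -> d.[x] ^+ 2 <= r.[x]) ->
  (mass n [set` `[a, +oo[] <= (p.[a] / d.[a] * expow n a)%:E)%E.
Proof.
move=> rd; rewrite mass.unlock -integral_f => [|x ax]; last first.
  by rewrite (le_trans _ (rd x ax))// sqr_ge0.
apply: ge0_le_integral => //.
- by move=> x _; rewrite lee_fin expow_ge0.
- exact: measurable_expow.
- move=> x; rewrite /= in_itv/= andbT => ax; rewrite lee_fin.
  rewrite ler_peMl ?expow_ge0// ler_pdivlMr ?exprn_gt0 ?d_gt0// mul1r.
  exact: rd.
Qed.

End tail_bounds.

Section interval_bounds.
Variables (R : realType) (m : nat) (q : {poly R}) (a b : R).
Hypothesis ab : a < b.
Local Notation mu := (@lebesgue_measure R).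
Local Notation n := m.+1.
Implicit Types x : R.

(** As for the tails: [F] is a primitive of [f], and comparing [r] with 1 on the interval bounds the
    mass. *)
Let F x := q.[x] * expow n x.
Let r := q^`() - n%:R *: 'X^m * q.
Let f x := r.[x] * expow n x.

Let is_derive_F x : is_derive x 1 F (f x).
Proof.
have de := is_derive_expow m x.
rewrite /F; apply: is_derive_eq.
by rewrite /f /r !hornerE /GRing.scale /=; ring.
Qed.

Let continuous_f : continuous f.
Proof.
by move=> x; apply: cvgM; [exact: continuous_horner|exact: continuous_expow].
Qed.

Let continuous_F : continuous F.
Proof.
by move=> x; apply: cvgM; [exact: continuous_horner|exact: continuous_expow].
Qed.

Let integral_f : (\int[mu]_(x in `[a, b]) (f x)%:E =
  (q.[b] * expow n b - q.[a] * expow n a)%:E)%E.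
Proof.
rewrite (@continuous_FTC2 _ f F a b)//.
- exact: continuous_subspaceT.
- split; [by move=> x _; case: (is_derive_F x)| |].
  + exact/cvg_at_right_filter/continuous_F.
  + exact/cvg_at_left_filter/continuous_F.
- by move=> x _; have df := is_derive_F x; rewrite derive1E derive_val.
Qed.

Let measurable_f : measurable_fun [set` `[a, b]] (EFin \o f).
Proof.
apply: measurable_funTS; apply/measurable_EFinP.
by apply: continuous_measurable_fun.
Qed.

Lemma mass_itv_ge : (forall x, a <= x <= b -> 0 <= r.[x] <= 1) ->
  ((q.[b] * expow n b - q.[a] * expow n a)%:E <= mass n [set` `[a, b]])%E.
Proof.
move=> r01; rewrite mass.unlock -integral_f.
apply: ge0_le_integral => //.
- move=> x; rewrite /= in_itv/= => axb; rewrite lee_fin.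
  by rewrite mulr_ge0 ?expow_ge0//; have /andP[] := r01 x axb.
- exact: measurable_expow.
- move=> x; rewrite /= in_itv/= => axb; rewrite lee_fin.
  by rewrite ler_piMl ?expow_ge0//; have /andP[] := r01 x axb.
Qed.

Lemma mass_itv_le : (forall x, a <= x <= b -> 1 <= r.[x]) ->
  (mass n [set` `[a, b]] <= (q.[b] * expow n b - q.[a] * expow n a)%:E)%E.
Proof.
move=> r1; rewrite mass.unlock -integral_f.
apply: ge0_le_integral => //.
- by move=> x _; rewrite lee_fin expow_ge0.
- exact: measurable_expow.
- move=> x; rewrite /= in_itv/= => axb; rewrite lee_fin.
  by rewrite ler_peMl ?expow_ge0//; exact: r1.
Qed.

End interval_bounds.

Section mass.
Variable R : realType.
Implicit Types (n : nat) (a b c : R).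

Lemma mass_split n a b : a <= b -> mass n [set` `[a, +oo[] =
  (mass n [set` `[a, b]] + mass n [set` `[b, +oo[])%E.
Proof.
move=> ab; rewrite mass.unlock (@itv_bndbnd_setU _ _ _ (BLeft b))//.
rewrite ge0_integral_setU//=.
- by rewrite integral_itv_bndo_bndc//; exact: measurable_expow.
- exact: measurable_expow.
- by move=> x _; rewrite lee_fin expow_ge0.
- apply/disj_setPS => x [] /=; rewrite !in_itv/= andbT => /andP[_ xb].
  by rewrite leNgt xb.
Qed.

Lemma mass_le_opp n c : ~~ odd n ->
  mass n [set` `]-oo, c]] = mass n [set` `[- c, +oo[] :> \bar R.
Proof.
move=> n_even; rewrite mass.unlock -[c in LHS]opprK.
rewrite (@ge0_integration_by_substitutionNy R (expow n)).
- by apply: eq_integral => x _; rewrite /= expow_opp.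
- exact/continuous_subspaceT/continuous_expow.
- by move=> x _; exact: expow_ge0.
Qed.

Lemma mass_setT n c : ~~ odd n -> mass n [set: measurableTypeR R] =
  (mass n [set` `[c, +oo[] + mass n [set` `[(- c)%R, +oo[])%E.
Proof.
move=> n_even; rewrite -mass_le_opp// addeC mass.unlock.
rewrite -set_itvNyy (@itv_bndbnd_setU _ _ _ (BRight c))//.
rewrite ge0_integral_setU//=.
- by rewrite integral_itv_obnd_cbnd//; exact: measurable_expow.
- exact: measurable_expow.
- by move=> x _; rewrite lee_fin expow_ge0.
- apply/disj_setPS => x [] /=; rewrite !in_itv/= andbT => xc.
  by rewrite ltNge xc.
Qed.

End mass.

(** * The inequality A < B *)

Section mass_comparison.
Variable R : realType.
Implicit Types x : R.

(* [q] is the series solution of [q' - 4 x^3 q = 1] truncated at degree 17. *)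
Lemma mass4_itv01_ge :
  (((1 + 4 / 5 + 16 / 45 + 64 / 585 + 256 / 9945) * expR (- 1))%:E <=
   mass 4 [set` `[0%R, 1%R : R]])%E.
Proof.
pose q c1 c2 c3 c4 : {poly R} :=
  'X + c1 *: 'X^5 + c2 *: 'X^9 + c3 *: 'X^13 + c4 *: 'X^17.
have qE c1 c2 c3 c4 x : (q c1 c2 c3 c4).[x] =
    x + c1 * x ^+ 5 + c2 * x ^+ 9 + c3 * x ^+ 13 + c4 * x ^+ 17.
  by rewrite !(hornerD, hornerZ, hornerXn, hornerX).
have q1 c1 c2 c3 c4 : (q c1 c2 c3 c4).[1] = 1 + c1 + c2 + c3 + c4.
  by rewrite qE !expr1n !mulr1.
have q0 c1 c2 c3 c4 : (q c1 c2 c3 c4).[0] = 0.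
  by rewrite qE !expr0n !mulr0 !addr0.
have dqE c1 c2 c3 c4 x : (q c1 c2 c3 c4)^`().[x] = 1 + 5 * c1 * x ^+ 4 +
    9 * c2 * x ^+ 8 + 13 * c3 * x ^+ 12 + 17 * c4 * x ^+ 16.
  rewrite !(derivD, derivZ, derivXn, derivX).
  by rewrite !(hornerD, hornerZ, hornerMn, hornerXn, hornerC)/=; ring.
have := @mass_itv_ge R 3 (q (4 / 5) (16 / 45) (64 / 585) (256 / 9945))
  0 1 ltr01.
rewrite q1 q0 mul0r subr0 {1}/expow expr1n.
apply => x /andP[x0 x1].
rewrite hornerD hornerN hornerM hornerZ hornerXn dqE qE.
(* The lower powers cancel; only the truncation term, with coefficient [4 * (256 / 9945)],
   remains. *)
rewrite [X in 0 <= X <= _](_ : _ = 1 - 1024 / 9945 * x ^+ 20); last by field.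
have := exprn_ge0 20 x0; have := exprn_ile1 20 x0 x1; lra.
Qed.

(* Here [q] is a truncation of the series solution of [q' - 2 x q = 1], with
   the last coefficient raised so that [q' - 2 x q >= 1] on [0, 1]. *)
Lemma mass2_itv01_le :
  (mass 2 [set` `[0%R, 1%R : R]] <=
   ((1 + 2 / 3 + 4 / 15 + 8 / 105 + 16 / 735) * expR (- 1))%:E)%E.
Proof.
pose q c1 c2 c3 c4 : {poly R} :=
  'X + c1 *: 'X^3 + c2 *: 'X^5 + c3 *: 'X^7 + c4 *: 'X^9.
have qE c1 c2 c3 c4 x : (q c1 c2 c3 c4).[x] =
    x + c1 * x ^+ 3 + c2 * x ^+ 5 + c3 * x ^+ 7 + c4 * x ^+ 9.
  by rewrite !(hornerD, hornerZ, hornerXn, hornerX).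
have q1 c1 c2 c3 c4 : (q c1 c2 c3 c4).[1] = 1 + c1 + c2 + c3 + c4.
  by rewrite qE !expr1n !mulr1.
have q0 c1 c2 c3 c4 : (q c1 c2 c3 c4).[0] = 0.
  by rewrite qE !expr0n !mulr0 !addr0.
have dqE c1 c2 c3 c4 x : (q c1 c2 c3 c4)^`().[x] = 1 + 3 * c1 * x ^+ 2 +
    5 * c2 * x ^+ 4 + 7 * c3 * x ^+ 6 + 9 * c4 * x ^+ 8.
  rewrite !(derivD, derivZ, derivXn, derivX).
  by rewrite !(hornerD, hornerZ, hornerMn, hornerXn, hornerC)/=; ring.
have := @mass_itv_le R 1 (q (2 / 3) (4 / 15) (8 / 105) (16 / 735)) 0 1 ltr01.
rewrite q1 q0 mul0r subr0 {1}/expow expr1n.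
apply => x /andP[x0 x1].
rewrite hornerD hornerN hornerM hornerZ hornerXn dqE qE.
(* The last coefficient [c4 = 16 / 735] solves [9 * c4 - 2 * c3 = 2 * c4], so that the two remaining
   terms cancel at 1. *)
rewrite [leRHS](_ : _ = 1 + 32 / 735 * (x ^+ 8 * (1 - x ^+ 2))); last by field.
have x8 : 0 <= x ^+ 8 * (1 - x ^+ 2).
  by apply: mulr_ge0; [exact: exprn_ge0|rewrite subr_ge0; exact: exprn_ile1].
lra.
Qed.

(** The quotient x / (4 x^4 + 3) matches the first two terms 1 / (4 x^3) - 3 / (16 x^7) of the
    asymptotic expansion of the tail divided by h; its value at 1 is 1/7. Here [r] is
    [d ^+ 2 - 12]. *)
Lemma mass4_tail1_ge :
  ((7^-1 * expR (- 1))%:E <= mass 4 [set` `[1%R : R, +oo[])%E.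
Proof.
pose d : {poly R} := 4 *: 'X^4 + 3%:P.
have dE x : d.[x] = 4 * x ^+ 4 + 3.
  by rewrite !(hornerD, hornerZ, hornerXn, hornerC).
have ddE x : d^`().[x] = 16 * x ^+ 3.
  rewrite !(derivD, derivZ, derivXn, derivC).
  by rewrite !(hornerD, hornerZ, hornerMn, hornerXn, hornerC)/=; ring.
clearbody d.
have := @mass_tail_ge R 3 'X d 1 1.
rewrite /expow dE hornerX !expr1n (_ : 1 / (4 * 1 + 3) = 7^-1); last by field.
have x4 x : 1 <= x -> 1 <= x ^+ 4 by move=> x1; exact: exprn_ege1.
apply => x x1; have {}x4 := x4 x x1; rewrite ?dE ?hornerX.
- lra.
- lra.
- have : x <= x ^+ 4 by rewrite exprS ler_peMr ?exprn_ege1//; lra.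
  lra.
- rewrite !(hornerD, hornerN, hornerM, hornerZ, hornerXn, hornerX).
  rewrite derivX hornerC ddE dE.
  rewrite [X in 0 <= X <= _](_ : _ = (4 * x ^+ 4 + 3) ^+ 2 - 12); last by ring.
  have : 7 ^+ 2 <= (4 * x ^+ 4 + 3) ^+ 2.
    by apply: lerXn2r; rewrite ?nnegrE; lra.
  lra.
Qed.

(** The quotient (x^2 + 1) / (2 x^3 + 3 x) is a convergent of the continued fraction of the tail
    divided by g; its value at 1 is 2/5. Here [r] is [d ^+ 2 + 3]. *)
Lemma mass2_tail1_le :
  (mass 2 [set` `[1%R : R, +oo[] <= (2 / 5 * expR (- 1))%:E)%E.
Proof.
pose p : {poly R} := 'X^2 + 1%:P.
pose d : {poly R} := 2 *: 'X^3 + 3 *: 'X.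
have pE x : p.[x] = x ^+ 2 + 1 by rewrite !(hornerD, hornerXn, hornerC).
have dE x : d.[x] = 2 * x ^+ 3 + 3 * x.
  by rewrite !(hornerD, hornerZ, hornerXn, hornerX).
have dpE x : p^`().[x] = 2 * x.
  rewrite !(derivD, derivXn, derivC).
  by rewrite !(hornerD, hornerMn, hornerXn, hornerC)/=; ring.
have ddE x : d^`().[x] = 6 * x ^+ 2 + 3.
  rewrite !(derivD, derivZ, derivXn, derivX).
  by rewrite !(hornerD, hornerZ, hornerMn, hornerXn, hornerC)/=; ring.
clearbody p d.
have := @mass_tail_le R 1 p d 1 1.
rewrite /expow dE pE !expr1n.
rewrite (_ : (1 + 1) / (2 * 1 + 3 * 1) = 2 / 5); last by field.
apply => x x1; rewrite ?dE ?pE.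
- have := exprn_ege1 3 x1; lra.
- have := exprn_ege1 2 x1; lra.
- have : x ^+ 2 <= x ^+ 3 by rewrite [leRHS]exprS ler_peMl ?sqr_ge0.
  by have := sqr_ge0 x; lra.
- rewrite !(hornerD, hornerN, hornerM, hornerZ, hornerXn) dpE ddE dE pE.
  rewrite [leRHS](_ : _ = (2 * x ^+ 3 + 3 * x) ^+ 2 + 3); last by ring.
  by rewrite lerDl.
Qed.

Lemma mass2_lt_mass4 :
  (mass 2 [set` `[0%R : R, +oo[] < mass 4 [set` `[0%R : R, +oo[])%E.
Proof.
rewrite !(mass_split _ ler01).
apply: (le_lt_trans (leeD mass2_itv01_le mass2_tail1_le)).
apply: (lt_le_trans _ (leeD mass4_itv01_ge mass4_tail1_ge)).
(* Without the factor exp(-1), the two sums are about 2.4313 and 2.4336. *)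
by rewrite -!EFinD lte_fin -!mulrDl ltr_pM2r ?expR_gt0//; lra.
Qed.

End mass_comparison.

(** * Power bounds for the tails, and finiteness of the mass *)

Section power_tails.
Variables (R : realType) (m : nat).
Implicit Types a x : R.
Local Notation n := m.+1.

(** The tail bounds are applied to [p = 1] and this denominator: [c = n] gives an upper bound, and
    [c = 2 n] a lower one, since m x^(m-1) <= n x^(2m) for x >= 1. *)
Let d c : {poly R} := c *: 'X^m.

Let dE c x : (d c).[x] = c * x ^+ m.
Proof. by rewrite hornerZ hornerXn. Qed.

Let rE c x :
  (n%:R *: 'X^m * 1%:P * d c - (1%:P)^`() * d c + 1%:P * (d c)^`()).[x] =
  c * (n%:R * (x ^+ m) ^+ 2 + m%:R * x ^+ m.-1).
Proof.
rewrite derivC mul0r subr0 mulr1 mul1r hornerD hornerM !hornerZ hornerXn.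
by rewrite derivZ derivXn hornerZ hornerMn hornerXn; ring.
Qed.

Lemma mass_power_tail_le a : 1 <= a ->
  (mass n [set` `[a, +oo[] <= ((n%:R * a ^+ m)^-1 * expow n a)%:E)%E.
Proof.
move=> a1; have n0 : 0 < n%:R :> R by rewrite ltr0n.
have := @mass_tail_le R m 1%:P (d n%:R) a 1; rewrite dE hornerC mul1r.
apply=> x ax; have xm : 1 <= x ^+ m by rewrite exprn_ege1// (le_trans a1).
- by rewrite dE mulr_gt0// (lt_le_trans ltr01).
- by rewrite hornerC.
- by rewrite dE hornerC mul1r mulr_ege1// ler1n.
- rewrite dE rE exprMn [in leLHS]expr2 -mulrA ler_pM2l// lerDl.
  by rewrite mulr_ge0// exprn_ge0// (le_trans _ ax)// (le_trans ler01).
Qed.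

Lemma mass_power_tail_ge a : 1 <= a ->
  (((2 * n%:R * a ^+ m)^-1 * expow n a)%:E <= mass n [set` `[a, +oo[])%E.
Proof.
move=> a1; have n0 : 0 < n%:R :> R by rewrite ltr0n.
have n20 : 0 < 2 * n%:R :> R by rewrite mulr_gt0.
have := @mass_tail_ge R m 1%:P (d (2 * n%:R)) a 1; rewrite dE hornerC mul1r.
apply=> x ax; have x1 := le_trans a1 ax;
  have xm : 1 <= x ^+ m by rewrite exprn_ege1.
- by rewrite dE mulr_gt0// (lt_le_trans ltr01).
- by rewrite hornerC.
- by rewrite dE hornerC mul1r !mulr_ege1// ?ler1n.
- have xm1 : 0 <= x ^+ m.-1 by rewrite exprn_ge0// (le_trans ler01).
  have xm2 : x ^+ m.-1 <= (x ^+ m) ^+ 2.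
    rewrite -exprM ler_weXn2l//; case: (m) => //= k.
    by rewrite (leq_trans (leqnSn _))// leq_pmulr.
  rewrite dE rE; apply/andP; split.
    apply: mulr_ge0; first exact: ltW.
    by apply: addr_ge0; apply: mulr_ge0; rewrite ?ler0n ?sqr_ge0.
  rewrite exprMn [(2 * n%:R) ^+ 2]expr2 -[leRHS]mulrA ler_pM2l//.
  have : m%:R * x ^+ m.-1 <= n%:R * (x ^+ m) ^+ 2 by rewrite ler_pM// ler_nat.
  lra.
Qed.

End power_tails.

Section finite_mass.
Variables (R : realType) (m : nat).
Hypothesis m_odd : odd m.
Local Notation n := m.+1.
Implicit Types a x : R.

Lemma mass_itv_fin (k : nat) (a b : R) :
  (mass k [set` `[a, b]] : \bar R) \is a fin_num.
Proof.
rewrite mass.unlock; apply: integrable_fin_num => //.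
apply: continuous_compact_integrable.
  exact: segment_compact.
exact/continuous_subspaceT/continuous_expow.
Qed.

(** Since [m] is odd, [n] is even and both half-lines have the same mass, which is bounded on [0, 1]
    by compactness and beyond 1 by the power bound. *)
Lemma mass_setT_lty : (mass n [set: measurableTypeR R] < +oo)%E.
Proof.
have n_even : ~~ odd n by rewrite /= negbK.
have t1 : (mass n [set` `[1%R : R, +oo[] < +oo)%E.
  by rewrite (le_lt_trans (mass_power_tail_le _ (lexx 1)))// ltry.
have t01 : (mass n [set` `[0%R, 1%R : R]] < +oo)%E.
  by rewrite -ge0_fin_numE ?mass_ge0// mass_itv_fin.
have t0 : (mass n [set` `[0%R : R, +oo[] < +oo)%E.
  by rewrite (mass_split _ ler01) lte_add_pinfty.
by rewrite (mass_setT 0 n_even) oppr0 lte_add_pinfty.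
Qed.

Lemma mass_fin_num (D : set (measurableTypeR R)) :
  measurable D -> mass n D \is a fin_num.
Proof.
move=> mD; rewrite ge0_fin_numE ?mass_ge0//.
by rewrite (le_lt_trans _ mass_setT_lty)// le_mass.
Qed.

End finite_mass.

(** * Tails and total masses as real numbers *)

Definition tail (R : realType) (n : nat) (a : R) : R :=
  fine (mass n [set` `[a, +oo[]).

Definition total (R : realType) (n : nat) : R :=
  fine (mass n [set: measurableTypeR R]).

Section tail.
Variables (R : realType) (m : nat).
Hypothesis m_odd : odd m.
Local Notation n := m.+1.
Local Notation T := (@tail R n).
Implicit Types a b : R.

Let n_even : ~~ odd n. Proof. by rewrite /= negbK. Qed.

(** The mass is finite, so [fine] never returns its default value 0 for an infinity. *)
Lemma mass_tailE a : mass n [set` `[a, +oo[] = (T a)%:E.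
Proof. by rewrite /tail fineK// mass_fin_num. Qed.

Lemma mass_totalE : mass n [set: measurableTypeR R] = (total R n)%:E.
Proof. by rewrite /total fineK// mass_fin_num. Qed.

Lemma tail_oppr a : T a + T (- a) = total R n.
Proof.
by apply: EFin_inj; rewrite EFinD -!mass_tailE -mass_totalE -mass_setT.
Qed.

Lemma tail0 : T 0 = total R n / 2.
Proof. by have := tail_oppr 0; rewrite oppr0; lra. Qed.

Lemma le_tail a b : a <= b -> T b <= T a.
Proof.
move=> ab; rewrite -lee_fin -!mass_tailE le_mass// => x /=.
by rewrite !in_itv/= !andbT; exact: le_trans.
Qed.

Lemma tail_le a : 1 <= a -> T a <= (n%:R * a ^+ m)^-1 * expow n a.
Proof. by move=> a1; rewrite -lee_fin -mass_tailE mass_power_tail_le. Qed.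

Lemma tail_ge a : 1 <= a -> (2 * n%:R * a ^+ m)^-1 * expow n a <= T a.
Proof. by move=> a1; rewrite -lee_fin -mass_tailE mass_power_tail_ge. Qed.

Lemma tail_gt0 a : 0 < T a.
Proof.
(* The lower bound is available from 1 on; monotonicity covers smaller [a]. *)
have m1 : 1 <= Num.max 1 a by rewrite le_max lexx.
apply: (@lt_le_trans _ _ (T (Num.max 1 a))); last first.
  by rewrite le_tail// le_max lexx orbT.
rewrite (lt_le_trans _ (tail_ge m1))// mulr_gt0 ?expow_gt0// invr_gt0.
by rewrite !mulr_gt0 ?ltr0n// exprn_gt0// (lt_le_trans ltr01).
Qed.

Lemma total_gt0 : 0 < total R n.
Proof. by rewrite -(tail_oppr 0) addr_gt0 ?tail_gt0. Qed.

(** The tails at 0 and at [a] differ by the mass of [0, a], which is at least [a * expow n a]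
    because [expow n] decreases there. *)
Lemma tail_ltr0 a : 0 < a -> T a < total R n / 2.
Proof.
move=> a0; rewrite -tail0 -lte_fin -!mass_tailE (mass_split _ (ltW a0)).
rewrite mass_tailE -(fineK (mass_itv_fin _ _ _)) -EFinD lte_fin ltrDr.
rewrite fine_gt0//; apply/andP; split; last first.
  by rewrite -ge0_fin_numE ?mass_ge0// mass_itv_fin.
rewrite mass.unlock.
apply: (@lt_le_trans _ _
  (\int[@lebesgue_measure R]_(x in `[0%R, a]) (expow n a)%:E)%E).
  rewrite integral_cst//= lebesgue_measure_itv/= lte_fin a0 -EFinB subr0.
  by rewrite -EFinM lte_fin mulr_gt0// expow_gt0.
apply: ge0_le_integral => //.
- by move=> x _; rewrite lee_fin expow_ge0.
- exact: measurable_expow.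
- move=> x; rewrite /= in_itv/= => /andP[x0 xa].
  by rewrite lee_fin ler_expR lerN2 lerXn2r// nnegrE (le_trans x0).
Qed.

End tail.

Lemma total2_lt_total4 (R : realType) : total R 2 < total R 4.
Proof.
have := mass2_lt_mass4 R; rewrite !mass_tailE// lte_fin !tail0//; lra.
Qed.

(** * Total mass and enclosed volumes *)

Lemma total_massE (R : realType) : total_mass R = (total R 2 * total R 4)%:E.
Proof.
by rewrite /total_mass -setXTT weighted_volume_setX// !mass_totalE// EFinM.
Qed.

(** The half-plane below [b] reflects to the one above [- b]. Replacing [b] by [s] leaves the
    perimeter unchanged and leaves only upper half-planes to consider. *)
Lemma hline_enclosesP (R : realType) (b v : R) : hline_encloses b v ->
  exists2 s, s = b \/ s = - b & v = total R 2 * tail 4 s.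
Proof.
have up c : weighted_volume [set p : plane R | c <= p.2] =
    (total R 2 * tail 4 c)%:E.
  rewrite EFinM -mass_totalE// -mass_tailE// -weighted_volume_setX//.
  congr weighted_volume; apply/seteqP; split => p /=; rewrite in_itv/= andbT//.
  by case.
have down c : weighted_volume [set p : plane R | p.2 <= c] =
    (total R 2 * tail 4 (- c))%:E.
  rewrite EFinM -mass_totalE// -mass_tailE// -mass_le_opp//.
  rewrite -weighted_volume_setX//.
  congr weighted_volume; apply/seteqP.
  by split => p /=; rewrite in_itv/=// => -[].
rewrite /hline_encloses up down => -[] [<-].
- by exists (- b) => //; right.
- by exists b => //; left.
Qed.

Lemma vline_enclosesP (R : realType) (a v : R) : vline_encloses a v ->
  exists2 t, t = a \/ t = - a & v = total R 4 * tail 2 t.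
Proof.
have up c : weighted_volume [set p : plane R | c <= p.1] =
    (total R 4 * tail 2 c)%:E.
  rewrite mulrC EFinM -mass_totalE// -mass_tailE// -weighted_volume_setX//.
  congr weighted_volume; apply/seteqP; split => p /=; rewrite in_itv/= andbT//.
  by case.
have down c : weighted_volume [set p : plane R | p.1 <= c] =
    (total R 4 * tail 2 (- c))%:E.
  rewrite mulrC EFinM -mass_totalE// -mass_tailE// -mass_le_opp//.
  rewrite -weighted_volume_setX//.
  congr weighted_volume; apply/seteqP.
  by split => p /=; rewrite in_itv/=// => -[].
rewrite /vline_encloses up down => -[] [<-].
- by exists (- a) => //; right.
- by exists a => //; left.
Qed.

(** * Comparison of the perimeters *)

Section comparison.
Variable R : realType.
Implicit Types b a s t v : R.
Local Notation A := (total R 2).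
Local Notation B := (total R 4).

Lemma length_hlineE b s : s = b \/ s = - b ->
  weighted_length (hline b) = (A * expow 4 s)%:E.
Proof.
move=> sb; rewrite weighted_length_hline mass_totalE// -EFinM mulrC.
by case: sb => ->; rewrite ?expow_opp.
Qed.

Lemma length_vlineE a t : t = a \/ t = - a ->
  weighted_length (Defs.vline a) = (B * expow 2 t)%:E.
Proof.
move=> ta; rewrite weighted_length_vline mass_totalE// -EFinM mulrC.
by case: ta => ->; rewrite ?expow_opp.
Qed.

Lemma horizontal_beats_near_half : exists2 e : R, 0 < e &
  forall s t, A * tail 4 s = B * tail 2 t ->
    `|tail 2 t / A - 1 / 2| < e -> A * expow 4 s < B * expow 2 t.
Proof.
have A0 : 0 < A := @total_gt0 R 1 isT.
have B0 : 0 < B := @total_gt0 R 3 isT.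
have AB := total2_lt_total4 R.
(* If [t ^+ 2 < c], then A < B (1 - t^2) <= B g(t), while a horizontal perimeter is at most A. *)
pose c := 1 - A / B.
have AB1 : A / B < 1 by rewrite ltr_pdivrMr// mul1r.
have AB0 : 0 < A / B by rewrite divr_gt0.
have c0 : 0 < c by rewrite subr_gt0.
exists (1 / 2 - tail 2 c / A).
  rewrite subr_gt0 ltr_pdivrMr//; have := @tail_ltr0 R 1 isT _ c0; lra.
move=> s t _ tA.
(* For [c <= |t|], the volume fraction is at most [tail 2 c / A] or at least 1 minus that, hence at
   distance at least [e] from 1/2. *)
have [tc|tc] := ltP `|t| c; last first.
  exfalso; move: tA; apply/negP; rewrite -leNgt.
  have TA : tail 2 `|t| / A <= tail 2 c / A.
    by rewrite ler_pM2r ?invr_gt0// le_tail.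
  have [t0|t0] := leP 0 t.
    rewrite ger0_norm// in TA.
    by rewrite distrC (le_trans _ (ler_norm _))//; lra.
  rewrite ltr0_norm// in TA.
  have -> : tail 2 t / A = 1 - tail 2 (- t) / A.
    by rewrite -(tail_oppr (isT : odd 1) t); field; rewrite tail_oppr ?gt_eqF.
  by rewrite (le_trans _ (ler_norm _))//; lra.
rewrite (@le_lt_trans _ _ A)//.
  rewrite ler_piMr ?(ltW A0)// -expR0 ler_expR oppr_le0.
  by rewrite -[4%N]/(2 * 2)%N exprM sqr_ge0.
rewrite mulrC -ltr_pdivrMr//.
(* As c < 1, the square of [t] is at most [|t|]. *)
have t2 : t ^+ 2 < c.
  rewrite -real_normK ?num_real// (le_lt_trans _ tc)// expr2 ler_piMl//.
  by rewrite (le_trans (ltW tc))// lerBlDr lerDl ltW.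
by have := expR_ge1Dx (- t ^+ 2); rewrite /expow; move: t2; rewrite /c; lra.
Qed.

(** The crude estimate [t < s ^+ 3] replaces t ~ s^2: with equal volumes, B g(t) <= 4 t v < 4 s^3 v
    <= A h(s) by the power bounds. *)
Lemma vertical_beats_small : exists2 e : R, 0 < e &
  forall s t, A * tail 4 s = B * tail 2 t -> A * tail 4 s < e ->
    B * expow 2 t < A * expow 4 s.
Proof.
have A0 : 0 < A := @total_gt0 R 1 isT.
have B0 : 0 < B := @total_gt0 R 3 isT.
(* The term 4 B / A defeats the constant in the comparison of exponentials below; the 2 makes s (s^2
   - 1) >= 1. *)
pose s0 := 2 + 4 * B / A.
(* By monotonicity of the tails, smaller volumes force [s0 < s] and [1 < t]. *)
exists (Num.min (A * tail 4 s0) (B * tail 2 1)).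
  by rewrite lt_min !mulr_gt0// tail_gt0.
move=> s t st; rewrite lt_min {2}st !ltr_pM2l// => /andP[ss0 t1].
have {}t1 : 1 < t.
  by rewrite ltNge; apply: contraL t1 => t1; rewrite -leNgt le_tail.
have {}ss0 : s0 < s.
  by rewrite ltNge; apply: contraL ss0 => ss0; rewrite -leNgt le_tail.
have BA : 0 < 4 * B / A by rewrite divr_gt0// mulr_gt0.
have s2 : 2 < s by rewrite (le_lt_trans _ ss0)// lerDl ltW.
have s1 : 1 <= s by lra.
have s_gt0 : 0 < s by lra.
have s3_ge1 : 1 <= s ^+ 3 by rewrite exprn_ege1.
have s3 : 0 < s ^+ 3 by rewrite exprn_gt0.
have ts3 : t < s ^+ 3.
  (* Otherwise the tail bounds give A h(s) <= 4 B g(s^3), that is, exp(s^6 - s^4) <= 4 B / A,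
     although the left side exceeds s > 4 B / A. *)
  rewrite ltNge; apply/negP => s3t.
  have h1 := tail_le (isT : odd 1) s3_ge1.
  have h2 := tail_ge (isT : odd 3) s1.
  have h3 := le_tail (isT : odd 1) s3t.
  rewrite expr1 in h1.
  have h4 : A * ((2 * 4 * s ^+ 3)^-1 * expow 4 s) <=
            B * ((2 * s ^+ 3)^-1 * expow 2 (s ^+ 3)).
    apply: (@le_trans _ _ (A * tail 4 s)); first by rewrite ler_pM2l.
    by rewrite st ler_pM2l// (le_trans h3).
  have h5 : A * expow 4 s <= 4 * B * expow 2 (s ^+ 3).
    have := h4; rewrite -(ler_pM2l (_ : 0 < 8 * s ^+ 3)) ?mulr_gt0//.
    rewrite [leLHS](_ : _ = A * expow 4 s); last by field; rewrite gt_eqF.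
    rewrite [leRHS](_ : _ = 4 * B * expow 2 (s ^+ 3))//.
    by field; rewrite gt_eqF.
  have h6 : expow 4 s = expow 2 (s ^+ 3) * expR (s ^+ 6 - s ^+ 4).
    by rewrite /expow -expRD; congr expR; ring.
  move: h5; rewrite h6 mulrCA [leRHS]mulrC ler_pM2l ?expow_gt0//.
  rewrite mulrC -ler_pdivlMr// => h5.
  have h7 := expR_ge1Dx (s ^+ 6 - s ^+ 4).
  have h8 : s <= s ^+ 6 - s ^+ 4.
    have s3s : s <= s ^+ 3 by rewrite [leRHS]exprS ler_peMr ?exprn_ege1// ltW.
    have -> : s ^+ 6 - s ^+ 4 = s ^+ 3 * (s * (s ^+ 2 - 1)) by ring.
    rewrite (le_trans s3s)// ler_peMr ?ltW//.
    by nra.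
  by move: ss0; rewrite /s0; lra.
have h1 := tail_ge (isT : odd 1) (ltW t1).
have h2 := tail_le (isT : odd 3) s1.
rewrite expr1 in h1.
have t0 : 0 < t by lra.
have e2 : expow 2 t <= 4 * t * tail 2 t.
  move: h1; rewrite mulrC ler_pdivrMr ?mulr_gt0//.
  by rewrite mulrC [2 * 2 * t](_ : _ = 4 * t)//; ring.
apply: (@le_lt_trans _ _ (4 * t * (A * tail 4 s))).
  by rewrite st mulrCA ler_pM2l.
apply: (@lt_le_trans _ _ (4 * s ^+ 3 * (A * tail 4 s))).
  by rewrite ltr_pM2r ?mulr_gt0 ?tail_gt0// ltr_pM2l.
by rewrite mulrCA ler_pM2l// mulrC -ler_pdivlMr ?mulr_gt0// mulrC.
Qed.

End comparison.

(** * The three ranges of volume *)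

Unset Implicit Arguments.

Theorem proposition4p3 (R : realType) :
  (total_mass R < +oo)%E /\
  (forall M : R, total_mass R = M%:E ->
    [/\ exists2 e : R, 0 < e & forall v : R, 0 < v < M ->
          `|v / M - 1 / 2| < e -> horizontal_beats_vertical v,
        exists2 e : R, 0 < e & forall v : R, 0 < v < M ->
          v < e -> vertical_beats_horizontal v
      & exists2 e : R, 0 < e & forall v : R, 0 < v < M ->
          M - e < v -> vertical_beats_horizontal v]).
Proof.
have A0 : 0 < total R 2 := @total_gt0 R 1 isT.
have B0 : 0 < total R 4 := @total_gt0 R 3 isT.
rewrite total_massE; split; first exact: ltry.
move=> _ [<-]; split.
- have [e e0 H] := horizontal_beats_near_half R.
  exists e => // v _ ve b a /hline_enclosesP[s sb vs] /vline_enclosesP[t ta vt].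
  rewrite (length_hlineE sb) (length_vlineE ta) lte_fin; apply: H.
    by rewrite -vs -vt.
  move: ve; rewrite vt [X in `|X - _|](_ : _ = tail 2 t / total R 2)//.
  by field; rewrite !gt_eqF.
- have [e e0 H] := vertical_beats_small R.
  exists e => // v _ ve a b /vline_enclosesP[t ta vt] /hline_enclosesP[s sb vs].
  rewrite (length_hlineE sb) (length_vlineE ta) lte_fin; apply: H.
    by rewrite -vs -vt.
  by rewrite -vs.
- have [e e0 H] := vertical_beats_small R.
  exists e => // v _ ve a b /vline_enclosesP[t ta vt] /hline_enclosesP[s sb vs].
  rewrite (length_hlineE sb) (length_vlineE ta) lte_fin.
  (* The tails at [- s] and [- t] correspond to the complementary volume M - v, which is below [e];
     the perimeters are even in [s] and [t]. *)
  have hs := tail_oppr (isT : odd 3) s; have ht := tail_oppr (isT : odd 1) t.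
  have {}hs : tail 4 (- s) = total R 4 - tail 4 s by lra.
  have {}ht : tail 2 (- t) = total R 2 - tail 2 t by lra.
  rewrite -(expow_opp s (isT : ~~ odd 4)) -(expow_opp t (isT : ~~ odd 2)).
  by apply: H; rewrite hs ?ht !mulrBr -vs -?vt; lra.
Qed.
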